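(* If $\mathscr{F}=\{f_t : t\in T\}$ is a (strong) Glivenko–Cantelli class for the probability measure $P$, then the estimator $\hat{\underline{\mathrm{E}}}_n(f)$ for $\underline{\mathrm{E}}^{\mathscr{P}}(f)$ is strongly consistent, meaning that $$\big|\hat{\underline{\mathrm{E}}}_n(f)-\underline{\mathrm{E}}^{\mathscr{P}}(f)\big|^*\to 0\quad P^\infty\text{-almost surely as }n\to+\infty.$$
   Context: Setting. $\mathscr{B}$ is the Borel $\sigma$-field on $\mathbb{R}$. $T$ is a non-empty index set (with no further structure), $\mathscr{P}=\{P_t : t\in T\}$ is a set of probability measures on $(\mathbb{R},\mathscr{B})$, and $P$ is a probability measure on $(\mathbb{R},\mathscr{B})$, not necessarily in $\mathscr{P}$. For a probability measure $Q$, $\mathrm{E}^Q(h)=\int h\,\mathrm{d}Q$. The map $f\colon\mathbb{R}\to\mathbb{R}$ is Borel measurable with $\sup_{t\in T}\mathrm{E}^{P_t}(|f|)<+\infty$, and $\underline{\mathrm{E}}^{\mathscr{P}}(f):=\inf_{t\in T}\mathrm{E}^{P_t}(f)$. For each $t\in T$, $f_t\colon\mathbb{R}\to\mathbb{R}$ is a Borel measurable map with $\mathrm{E}^P(f_t)=\mathrm{E}^{P_t}(f)$ and $\mathrm{E}^P(|f_t|)=\mathrm{E}^{P_t}(|f|)$ (so each $f_t$ is $P$-integrable). Sampling. $(\mathbb{R}^\infty,\mathscr{B}^\infty,P^\infty)$ is the countably infinite product of copies of $(\mathbb{R},\mathscr{B},P)$ and $X_k\colon\mathbb{R}^\infty\to\mathbb{R}$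 is the $k$-th coordinate projection. For $\phi\colon\mathbb{R}\to\mathbb{R}$ and $n\geq 1$, $\hat{\mathrm{E}}^P_n(\phi):=\frac1n\sum_{k=1}^n\phi(X_k)$. The estimator is the (not necessarily measurable) extended real-valued map $\hat{\underline{\mathrm{E}}}_n(f):=\inf_{t\in T}\hat{\mathrm{E}}^P_n(f_t)$ on $\mathbb{R}^\infty$. Measurable covers. For any map $h\colon\mathbb{R}^\infty\to\overline{\mathbb{R}}:=\mathbb{R}\cup\{-\infty,+\infty\}$, $h^*$ denotes a minimal measurable cover: a measurable map $h^*\colon\mathbb{R}^\infty\to\overline{\mathbb{R}}$ with $h^*\geqslant h$ and such that every measurable $g\colon\mathbb{R}^\infty\to\overline{\mathbb{R}}$ with $g\geqslant h$ satisfies $g\geqslant h^*$ $P^\infty$-almost surely; it always exists and is unique up to $P^\infty$-null sets. $|h|^*$ is the minimal measurable cover of $|h|$. Glivenko–Cantelli. A class $\Phi$ of Borel measurable, $P$-integrable maps $\phi\colon\mathbb{R}\to\mathbb{R}$ is a (strong) Glivenko–Cantelli class for $P$ if $\big(\sup_{\phi\in\Phi}|\hat{\mathrm{E}}^P_n(\phi)-\mathrm{E}^P(\phi)|\big)^*\to0$ $P^\infty$-almost surely as $n\to+\infty$. *)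

(* Defs.v *)
From HB Require Import structures.
From mathcomp Require Import all_boot all_order all_algebra.
From mathcomp Require Import all_classical all_reals all_analysis measurable_realfun.

Set Implicit Arguments.
Unset Strict Implicit.
Unset Printing Implicit Defensive.

Import Order.TTheory GRing.Theory Num.Theory.
Import numFieldNormedType.Exports.

Local Open Scope classical_set_scope.
Local Open Scope ring_scope.
Local Open Scope ereal_scope.

Section Sampling.
Context {R : realType}.

Definition cylinders1 : set (set (nat -> R)) :=
  \bigcup_k preimage_set_system setT (fun x : nat -> R => x k) measurable.

(* The k-th observation X_k, k >= 1, is the coordinate of index k.-1. *)
Definition Rinfty := g_sigma_algebraType cylinders1.

(* By uniqueness of the infinite product measure, this determines Q. *)
Definition is_infinite_power (P : probability (measurableTypeR R) R)
    (Q : probability Rinfty R) : Prop :=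
  forall (n : nat) (A : nat -> set (measurableTypeR R)),
    (forall k, measurable (A k)) ->
    Q [set x : Rinfty | forall k, (k < n)%N -> A k (x k)] =
    \prod_(k < n) P (A k).

(* At n = 0 this is 0, which is irrelevant to limits in n. *)
Definition empirical_mean (n : nat) (phi : R -> R) (x : Rinfty) : R :=
  (n%:R^-1 * \sum_(k < n) phi (x k))%R.

End Sampling.
Arguments Rinfty R : clear implicits.

Section MeasurableCover.
Context {d : measure_display} {X : measurableType d} {R : realType}.
Implicit Types (mu : probability X R) (h : X -> \bar R).

Definition is_minimal_cover mu h (hs : X -> \bar R) : Prop :=
  [/\ measurable_fun [set: X] hs,
      forall x, h x <= hs x &
      forall g : X -> \bar R, measurable_fun [set: X] g ->
        (forall x, h x <= g x) -> {ae mu, forall x, hs x <= g x}].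

(* A cover always exists, so the default value is never used. *)
Definition minimal_cover mu h : X -> \bar R :=
  xget (cst +oo) [set hs | is_minimal_cover mu h hs].

Definition outer_as_cvg0 mu (h : nat -> X -> \bar R) : Prop :=
  {ae mu, forall x, minimal_cover mu (h n) x @[n --> \oo] --> 0}.

End MeasurableCover.

Section Estimation.
Context {R : realType}.
Implicit Types (P : probability (measurableTypeR R) R).

Definition Glivenko_Cantelli P (Pinf : probability (Rinfty R) R)
    (Phi : set (R -> R)) : Prop :=
  (forall phi, Phi phi -> measurable_fun setT phi /\
     P.-integrable setT (EFin \o phi)) /\
  outer_as_cvg0 Pinf (fun n x =>
    ereal_sup [set `|(empirical_mean n phi x)%:E - 'E_P[phi]| | phi in Phi]).

Definition lower_expectation (T : Type)
    (Pt : T -> probability (measurableTypeR R) R) (f : R -> R) : \bar R :=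
  ereal_inf (range (fun t => 'E_(Pt t)[f])).

Definition lower_estimator (T : Type) (ft : T -> R -> R) (n : nat)
    (x : Rinfty R) : \bar R :=
  ereal_inf (range (fun t => (empirical_mean n (ft t) x)%:E)).

End Estimation.

(* Main.v *)
(* An infimum is 1-Lipschitz for the uniform distance, so the estimation error
   is at most the Glivenko-Cantelli supremum pointwise. Minimal measurable
   covers are almost surely monotone, so this bound passes to the covers, which
   are squeezed to 0. This needs the cover of the error to
   exist, and the lower expectation to be finite. *)
Require Import Defs.
From HB Require Import structures.
From mathcomp Require Import all_boot all_order all_algebra.
From mathcomp Require Import all_classical all_reals all_analysis measurable_realfun.

Import Order.TTheory GRing.Theory Num.Theory.
Import numFieldNormedType.Exports.

Local Open Scope classical_set_scope.
Local Open Scope ring_scope.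
Local Open Scope ereal_scope.

Lemma ereal_rat_dense (R : realType) (x y : \bar R) : x < y ->
  exists q : rat, x < (ratr q)%:E < y.
Proof.
have dense (a b : R) : (a < b)%R ->
    exists q : rat, (a%:E < (ratr q)%:E) && ((ratr q)%:E < b%:E).
  by move=> /rat_in_itvoo[q]; rewrite in_itv/=; exists q; rewrite !lte_fin.
case: x y => [a| |] [b| |] //=.
- by rewrite lte_fin; exact: dense.
- move=> _; have [|q /andP[aq _]] := dense a (a + 1)%R.
    by rewrite ltrDl.
  by exists q; rewrite aq ltry.
- move=> _; have [|q /andP[_ qb]] := dense (b - 1)%R b.
    by rewrite ltrBlDr ltrDl.
  by exists q; rewrite qb ltNyr.
- by move=> _; exists 0%R; rewrite ltNyr ltry.
Qed.

(** The infimum of the measures of measurable supersets of [S] is attained, by intersecting a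
    minimizing sequence. *)
Lemma minimal_measurable_superset d (X : measurableType d) (R : realType)
    (mu : {finite_measure set X -> \bar R}) (S : set X) :
  exists A, [/\ measurable A, S `<=` A &
    forall B, measurable B -> S `<=` B -> mu (A `\` B) = 0].
Proof.
pose supersets := [set A | measurable A /\ S `<=` A].
pose m := ereal_inf (mu @` supersets).
have m_le A : supersets A -> m <= mu A.
  by move=> sA; apply: ereal_inf_lbound; exists A.
have m_fin : m \is a fin_num.
  rewrite ge0_fin_numE; last by apply: le_ereal_inf_tmp => _ [A _ <-].
  apply: le_lt_trans (m_le setT _) _; first by split.
  by rewrite ltey_eq fin_num_measure.
have /choice[A_ A_P] (n : nat) :
    exists A, supersets A /\ mu A < m + (n.+1%:R^-1)%:E.
  have [|_ [A sA <-] ltA] := @lb_ereal_inf_adherent _ _ (n.+1%:R^-1)%R _ m_fin.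
    by rewrite invr_gt0.
  by exists A.
pose A := \bigcap_n A_ n.
have mA : measurable A.
  by apply: bigcapT_measurable => n; case: (A_P n) => -[].
have SA : S `<=` A by move=> x Sx n _; case: (A_P n) => -[_ SAn] _; exact: SAn.
have muA : mu A <= m.
  apply/lee_addgt0Pr => e e0; have [n ne] := ltr_add_invr e0.
  case: (A_P n) => -[mAn _] /ltW ltA.
  apply: le_trans (le_measure mu _ _ _) _; [by rewrite inE|by rewrite inE; exact: mAn| |].
    exact: bigcap_inf.
  apply: (le_trans ltA); rewrite leeD2l// lee_fin ltW//.
  by rewrite add0r in ne.
(* [A] intersected with [B] is again a measurable superset of [S], so its measure is at least [m],
   hence at least [mu A]; finiteness allows the subtraction. *)
exists A; split=> // B mB SB; apply/eqP; rewrite -measure_le0.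
rewrite measureD//; last by rewrite ltey_eq fin_num_measure.
rewrite leeBlDr ?fin_num_measure//; last exact: measurableI.
rewrite add0e; apply: (le_trans muA); apply: m_le; split; first exact: measurableI.
by move=> x Sx; split; [exact: SA|exact: SB].
Qed.

(* The cover is assembled from covers of the superlevel sets of [h] at all
   rational levels. *)
Lemma is_minimal_cover_exists d (X : measurableType d) (R : realType)
    (mu : probability X R) (h : X -> \bar R) :
  exists hs, is_minimal_cover mu h hs.
Proof.
(* An enumeration of the rationals; a code of no rational gets [-oo], which adds nothing to the
   supremum [hs]. *)
pose r (n : nat) : \bar R :=
  if @unpickle rat n is Some q then (ratr q)%:E else -oo.
have /choice[A A_P] := fun n : nat =>
  minimal_measurable_superset _ _ _ mu [set x | r n < h x].
pose level n x : \bar R := if x \in A n then r n else -oo.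
pose hs x := esups (level ^~ x) 0%N.
have level_le n x : level n x <= hs x.
  by apply: ereal_sup_ubound; exists n.
exists hs; split.
- apply: measurable_fun_esups => n; apply: measurable_fun_ifT => //.
  by apply: (measurable_fun_bool true); rewrite setTI preimage_mem_true; case: (A_P n).
(* A rational [q] strictly between [hs x] and [h x] would put [x] in the superset at level [q],
   forcing [hs x] to be at least [q]. *)
- move=> x; rewrite leNgt; apply/negP => /ereal_rat_dense[q /andP[hsq qh]].
  have [_ sub _] := A_P (pickle q).
  have := level_le (pickle q) x; rewrite /level ifT.
    by rewrite /r pickleK leNgt hsq.
  by rewrite inE; apply: sub; rewrite /= /r pickleK.
- move=> g mg hg.
  have ae_n n : {ae mu, forall x, level n x <= g x}.
    have [mA _ minA] := A_P n.
    (* This set contains the superlevel set of [h], so by minimality it contains [A n] up to a null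
       set. Only countably many levels occur, so the null sets can be merged. *)
    have mB : measurable [set x | r n < g x].
      by rewrite -[X in measurable X]setTI; exact: emeasurable_fun_o_infty.
    exists (A n `\` [set x | r n < g x]); split; first exact: measurableD.
      by apply: minA => // x /= /lt_le_trans; exact.
    move=> x /=; rewrite /level; case: ifPn => [|_]; last by rewrite leNye.
    by rewrite inE => An /negP; rewrite -ltNge => gr; split => //=; apply/negP;
      rewrite -leNgt ltW.
  apply: filterS (ae_foralln ae_n) => x le_g.
  by apply: ge_ereal_sup => _ [n _ <-].
Qed.

Lemma minimal_coverP d (X : measurableType d) (R : realType)
    (mu : probability X R) (h : X -> \bar R) :
  is_minimal_cover mu h (minimal_cover mu h).
Proof.
have [hs hsP] := is_minimal_cover_exists _ _ _ mu h.
exact: (xgetPex _ (ex_intro _ hs hsP)).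
Qed.

Lemma le_outer_as_cvg0 d (X : measurableType d) (R : realType)
    (mu : probability X R) (h g : nat -> X -> \bar R) :
  (forall n x, 0 <= h n x) -> (forall n x, h n x <= g n x) ->
  outer_as_cvg0 mu g -> outer_as_cvg0 mu h.
Proof.
move=> h0 hg g0.
have le_covers n :
    {ae mu, forall x, minimal_cover mu (h n) x <= minimal_cover mu (g n) x}.
  (* The cover of [g n] is a measurable majorant of [h n], so minimality applies to it. *)
  have [_ _] := minimal_coverP _ _ _ mu (h n); apply.
    by have [] := minimal_coverP _ _ _ mu (g n).
  move=> x; apply: (le_trans (hg n x)).
  by have [] := minimal_coverP _ _ _ mu (g n).
apply: filterS2 g0 (ae_foralln le_covers) => x gx0 le_x.
apply: (squeeze_cvge _ (cvg_cst 0) gx0); near=> n.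
rewrite le_x andbT; apply: (le_trans (h0 n x)).
by have [] := minimal_coverP _ _ _ mu (h n).
Unshelve. all: by end_near. Qed.

Lemma dist_ereal_inf_le_sup (R : realType) (T : Type) (a b : T -> \bar R) :
  (forall t, a t \is a fin_num) -> (forall t, b t \is a fin_num) ->
  ereal_inf (range b) \is a fin_num ->
  `|ereal_inf (range a) - ereal_inf (range b)| <=
    ereal_sup (range (fun t => `|a t - b t|)).
Proof.
move=> a_fin b_fin inf_fin; set D := ereal_sup _.
have abD t : `|a t - b t| <= D by apply: ereal_sup_ubound; exists t.
(* Over an empty index type the infimum would be [+oo], against [inf_fin]. An index is needed for
   [D] to be nonnegative. *)
have [t0] : exists t : T, True.
  apply: contrapT => noT; move: inf_fin.
  by rewrite (_ : range b = set0) ?ereal_inf0// -subset0 => y [t _ _]; apply: noT; exists t.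
move=> _; have D0 : 0 <= D := le_trans (abse_ge0 _) (abD t0).
have [->|Dy] := eqVneq D +oo; first by rewrite leey.
have D_fin : D \is a fin_num by rewrite ge0_fin_numE// ltey.
have inf_le (u v : T -> \bar R) : (forall t, u t <= v t + D) ->
    ereal_inf (range u) <= ereal_inf (range v) + D.
  move=> uv; rewrite -leeBlDr//; apply: le_ereal_inf_tmp => _ [t _ <-].
  by rewrite leeBlDr//; apply: le_trans (uv t); apply: ereal_inf_lbound; exists t.
have ab : ereal_inf (range a) <= ereal_inf (range b) + D.
  apply: inf_le => t; rewrite addeC -leeBlDr//.
  exact: le_trans (lee_abs _) (abD t).
have ba : ereal_inf (range b) <= ereal_inf (range a) + D.
  apply: inf_le => t; rewrite addeC -leeBlDr//.
  by apply: le_trans (abD t); rewrite -abseN fin_num_oppeB// addeC lee_abs.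
move: inf_fin D_fin ab ba.
case: (ereal_inf (range b)) D {abD D0 Dy inf_le} => [y| |] [d| |] //= _ _.
(* The infimum of [a] is not assumed finite: [ab] excludes [+oo] and [ba] excludes [-oo]. *)
case: (ereal_inf (range a)) => [x| |] //=; rewrite -!EFinD !lee_fin => xy yx.
by rewrite ler_distl lerBlDr xy andbT.
Qed.

Theorem theorem5 (R : realType) (T : Type) (T_nonempty : inhabited T)
  (Pt : T -> probability (measurableTypeR R) R)
  (P : probability (measurableTypeR R) R)
  (Pinf : probability (Rinfty R) R)
  (Pinf_power : is_infinite_power P Pinf)
  (f : R -> R) (mf : measurable_fun setT f)
  (f_bounded : ereal_sup (range (fun t => 'E_(Pt t)[fun y => `|f y|%R])) < +oo)
  (ft : T -> R -> R)
  (mft : forall t, measurable_fun setT (ft t))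
  (ft_mean : forall t, 'E_P[ft t] = 'E_(Pt t)[f])
  (ft_abs_mean : forall t,
    'E_P[fun y => `|ft t y|%R] = 'E_(Pt t)[fun y => `|f y|%R]) :
  Glivenko_Cantelli P Pinf (range ft) ->
  outer_as_cvg0 Pinf (fun n x =>
    `|lower_estimator ft n x - lower_expectation Pt f|).
Proof.
move=> [ft_int GC].
(* The mean is transferred to [P], where the triangle inequality for integrals applies to [ft t];
   [ft_abs_mean] transfers the bound back. *)
have f_le t : `|'E_(Pt t)[f]| <=
    ereal_sup (range (fun t => 'E_(Pt t)[fun y => `|f y|%R])).
  apply: (@le_trans _ _ 'E_P[fun y => `|ft t y|%R]).
    rewrite -ft_mean unlock; apply: le_trans (le_abse_integral _ _ _) _ => //.
    have [_ intf] := ft_int (ft t) (imageT ft t); exact: (measurable_int _ intf).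
  by rewrite ft_abs_mean; apply: ereal_sup_ubound; exists t.
have f_fin t : 'E_(Pt t)[f] \is a fin_num.
  by rewrite fin_num_abs; exact: le_lt_trans (f_le t) f_bounded.
have low_fin : lower_expectation Pt f \is a fin_num.
  have [t0] := T_nonempty.
  rewrite fin_numElt; apply/andP; split; last first.
    apply: (@le_lt_trans _ _ 'E_(Pt t0)[f]); last by rewrite ltey_eq f_fin.
    by apply: ereal_inf_lbound; exists t0.
  (* Finiteness of each mean would not keep the infimum above [-oo]; the bound uniform in [t]
     does. *)
  apply: (@lt_le_trans _ _
    (- ereal_sup (range (fun t => 'E_(Pt t)[fun y => `|f y|%R])))).
    by rewrite lteNr.
  apply: le_ereal_inf_tmp => _ [t _ <-].
  by rewrite leeNl; apply: le_trans (f_le t); rewrite -abseN lee_abs.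
apply: le_outer_as_cvg0 GC => // n x.
have := dist_ereal_inf_le_sup _ _ (fun t => (empirical_mean n (ft t) x)%:E) _
  (fun=> erefl) f_fin low_fin.
(* By [ft_mean], each distance is the deviation of an empirical mean of [ft t] from its own
   [P]-mean, a term of the Glivenko-Cantelli supremum. *)
move=> /le_trans; apply; apply: ge_ereal_sup => _ [t _ <-].
apply: ereal_sup_ubound; exists (ft t); first by exists t.
by rewrite ft_mean.
Qed.
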